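(* Let $G$ be a graph with $n$ vertices, and for a fixed value of $k$ let $$B_G=\begin{bmatrix}0&\partial_{k-1}^G&0\\ \partial_{k-1}^{G\dagger}&0&\partial_k^G\\ 0&\partial_k^{G\dagger}&0\end{bmatrix},$$ where the blocks indicate the subspaces $\mathcal{H}_{k-1}^G$, $\mathcal{H}_k^G$ and $\mathcal{H}_{k+1}^G$. The complexity of filtering out nonzero eigenvalues of $B_G$ by a factor of $\epsilon$ is $$\frac{n}{\lambda_{\min}}\ln(2/\epsilon)$$ calls to the block encoding of $B_G$, given that the gap from eigenvalue $0$ is at least $\lambda_{\min}$.
   Context: The $n$ vertices of $G$ are represented by $n$ qubits; $\mathcal{H}_j^G$ is the span of the computational basis states $|x\rangle$, $x\in\{0,1\}^n$, whose ones form a $j$-clique of $G$. The boundary map $\partial_j^G:\mathcal{H}_{j+1}^G\to\mathcal{H}_j^G$ is $\partial_j^G|x\rangle=\sum_{i=0}^{j}(-1)^i|x\backslash(i)\rangle$, where $x\backslash(i)$ is $x$ with its $i$-th one (counting from $0$) set to $0$. The gap condition means that every nonzero eigenvalue of $B_G$ has absolute value at least $\lambda_{\min}$. The block encoding of $B_G$ is a unitary $V$ on an ancilla together with the system such that $(|0\rangle\langle 0|\otimes P)V(|0\rangle\langle 0|\otimes P)=|0\rangle\langle 0|\otimes B_G/\lambda$ with $\lambda=n$, where $P$ is the projector onto $\mathcal{H}_{k-1}^G\oplus\mathcal{H}_k^G\oplus\mathcal{H}_{k+1}^G$; it is used through the walk operator $W=i(2|0\rangle\langle0|\otimes P-I)V$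 and its inverse. Filtering out nonzero eigenvalues by a factor of $\epsilon$ means applying an (approximate) projection onto the zero eigenspace of $B_G$, implemented as a linear combination of unitaries, in which the amplitudes for eigenstates with nonzero eigenvalue are multiplied by factors of absolute value at most $\epsilon$, while those for eigenvalue $0$ are not reduced.
   Formalization: The number of calls (n/λ_min)ln(2/ε) is rounded up to an even integer, since it need not be an integer and one call fails even when it equals 1 (e.g. n=2, no edges, k=1, λ_min=√2); the claim is read as an upper bound for 0<ε≤1. *)

(* Defs.v *)
From mathcomp Require Import all_boot all_order all_algebra.
From mathcomp Require Import all_classical all_reals all_analysis.
From mathcomp Require Import complex mxtens.

Set Implicit Arguments.
Unset Strict Implicit.
Unset Printing Implicit Defensive.

Import Order.TTheory GRing.Theory Num.Theory.
Local Open Scope sesquilinear_scope.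
Local Open Scope complex_scope.
Local Open Scope ring_scope.

Notation bits n := {ffun 'I_n -> bool}.

(* The n qubits span a space of dimension 2 ^ n, whose basis is enumerated by
   [enum_rank]. *)
Definition qdim (n : nat) : nat := #|bits n|.

Section Homology.
Variables (R : realType) (n : nat) (e : rel 'I_n).
Local Notation C := R[i].

Definition ket (x : bits n) : 'cV[C]_(qdim n) := delta_mx (enum_rank x) 0.

Definition ketbra (y x : bits n) : 'M[C]_(qdim n) := ket y *m (ket x)^t*.

Definition ones (x : bits n) : {set 'I_n} := [set v | x v].

(* As in the boundary formula, a j-clique has j vertices, hence dimension
   j - 1 as a simplex. *)
Definition is_clique (j : nat) (x : bits n) : bool :=
  (#|ones x| == j)
  && [forall u in ones x, forall v in ones x, (u != v) ==> e u v].

(* The i-th one (from 0) is the one preceded by exactly i ones in the order of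
   the qubits. *)
Definition clear_one (x : bits n) (i : nat) : bits n :=
  [ffun v => x v && (#|[set u in ones x | (u < v)%N]| != i)].

(* The boundary map from the span of the (j+1)-cliques to that of the
   j-cliques, extended by 0 to all n qubits. *)
Definition boundary (j : nat) : 'M[C]_(qdim n) :=
  \sum_(x : bits n | is_clique j.+1 x)
    \sum_(i < j.+1) (-1) ^+ i *: ketbra (clear_one x i) x.

Definition clique_proj (j : nat) : 'M[C]_(qdim n) :=
  \sum_(x : bits n | is_clique j x) ketbra x x.

Definition PG (k : nat) : 'M[C]_(qdim n) :=
  clique_proj k.-1 + clique_proj k + clique_proj k.+1.

(* The sum of the four nonzero blocks, each extended by 0: this is the block
   operator on the range of [PG k], extended by 0. It is only meant for
   0 < k. *)
Definition BG (k : nat) : 'M[C]_(qdim n) :=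
  boundary k.-1 + (boundary k.-1)^t* + boundary k + (boundary k)^t*.

(* Extending by 0 does not change the nonzero eigenvalues. *)
Definition gap_at_least (k : nat) (lmin : R) : Prop :=
  forall mu : C, eigenvalue (BG k) mu -> mu != 0 -> lmin%:C <= `|mu|.

Section Walk.
Variable a : nat. (* The ancilla has dimension a + 1 and |0> has index 0. *)

Definition anc0 (k : nat) : 'M[C]_(a.+1 * qdim n) :=
  (delta_mx 0 0 : 'M[C]_a.+1) *t PG k.

Definition block_encoding (k : nat) (V : 'M[C]_(a.+1 * qdim n)) : Prop :=
  V \is unitarymx /\
  anc0 k *m V *m anc0 k = (delta_mx 0 0 : 'M[C]_a.+1) *t (n%:R^-1 *: BG k).

Definition refl (k : nat) : 'M[C]_(a.+1 * qdim n) := 2 *: anc0 k - 1%:M.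

Definition walk (k : nat) (V : 'M[C]_(a.+1 * qdim n)) : 'M[C]_(a.+1 * qdim n) :=
  'i%C *: (refl k *m V).

End Walk.
End Homology.

(* Gates of a select operation. Each one is controlled: it acts on the ancilla
   and the system when the control register is in the given set of basis
   states, and as the identity otherwise. *)
Inductive gate (m : nat) : Type :=
| Refl of {set 'I_m}
| Walk of {set 'I_m}
| WalkInv of {set 'I_m}.

(* Walk and its inverse each use V or its inverse once; Refl does not. *)
Definition gate_calls (m : nat) (g : gate m) : nat :=
  match g with Refl _ => 0 | Walk _ => 1 | WalkInv _ => 1 end%N.

(* A linear combination of unitaries: the control register is prepared with
   amplitudes of modulus [sqrt `|lcu_weight c j|], the gates are applied in
   order, and the control register is unprepared, the phases of the weights
   going into either of these two preparations. As the weights have total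
   modulus 1, this implements the combination with no loss of amplitude. The
   data mention neither the graph nor the block encoding. *)
Record lcu (R : realType) : Type := Lcu {
  lcu_terms : nat;
  lcu_weight : 'I_lcu_terms -> R[i];
  lcu_gates : seq (gate lcu_terms);
  lcu_weight_sum : \sum_(j < lcu_terms) `|lcu_weight j| = 1 }.
Arguments lcu_weight {R} _ _.

Definition lcu_calls (R : realType) (c : lcu R) : nat :=
  (\sum_(g <- lcu_gates c) gate_calls g)%N.

Section Semantics.
Variables (R : realType) (n : nat) (e : rel 'I_n) (k a : nat).
Variable V : 'M[R[i]]_(a.+1 * qdim n).

(* What a gate does to the ancilla and the system when the control register is
   in state j. *)
Definition gate_on (m : nat) (j : 'I_m) (g : gate m) :
    'M[R[i]]_(a.+1 * qdim n) :=
  match g with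
  | Refl D => if j \in D then refl R e a k else 1%:M
  | Walk D => if j \in D then walk e k V else 1%:M
  | WalkInv D => if j \in D then invmx (walk e k V) else 1%:M
  end.

Definition lcu_op (c : lcu R) : 'M[R[i]]_(a.+1 * qdim n) :=
  \sum_(j < lcu_terms c)
    lcu_weight c j *: foldl (fun U g => gate_on j g *m U) 1%:M (lcu_gates c).

Definition filters (eps : R) (c : lcu R) : Prop :=
  forall (psi : 'cV[R[i]]_(qdim n)) (mu : R[i]),
    psi != 0 -> PG R e k *m psi = psi -> BG R e k *m psi = mu *: psi ->
    let phi : 'cV[R[i]]_(a.+1 * qdim n) :=
      (delta_mx 0 0 : 'cV[R[i]]_a.+1) *t psi in
    (mu = 0 -> lcu_op c *m phi = phi) /\
    (mu != 0 -> exists2 f : R[i],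
       lcu_op c *m phi = f *: phi & `|f| <= eps%:C).

End Semantics.

(* Main.v *)
(* Write [P = |0><0| (x) PG], [R = 2 P - 1] and [G = R V^t* R V]; since
   [W = i R V], [G] is [R W^-1 R W]. If [phi = |0> (x) psi] with
   [BG psi = mu psi] and [x = mu / n], put [s = R V^t* phi]. Then
   [G phi = 2 x s - phi] and [G s = 2 x G phi - s], so that [phi, s, G phi, G s,
   G^2 phi, ...] satisfies the Chebyshev recurrence and
   [P G^j phi = T_{2j}(x) phi], although [V] need not be self-inverse.

   The filter is the Dolph-Chebyshev window [eps T_{2h}(beta sqrt(1 - x^2))],
   with [beta = cosh (arccosh (1 / eps) / 2h)], so that it is 1 at [x = 0]. It
   has modulus at most [eps] as soon as [beta^2 (1 - x^2) <= 1], that is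
   [|x| >= tanh (arccosh (1 / eps) / 2h)], which holds for [|x| >= lmin / n] if
   [2h >= n / lmin * ln (2 / eps)]. As [beta >= 1], the coefficients of
   [T_{2h}(beta y)] in the basis [T_m(y)] are nonnegative, and as
   [T_{2j}(sqrt(1 - x^2)) = (-1)^j T_{2j}(x)] the window is a combination of the
   [P G^j P], [j <= h], with weights of total modulus 1. *)
Require Import Defs.
From mathcomp Require Import all_boot all_order all_algebra.
From mathcomp Require Import all_classical all_reals all_analysis.
From mathcomp Require Import complex mxtens.
From mathcomp Require Import ring lra zify.

Import Order.TTheory GRing.Theory Num.Theory numFieldNormedType.Exports.
Local Open Scope sesquilinear_scope.
Local Open Scope complex_scope.
Local Open Scope ring_scope.

(** * Chebyshev polynomials *)

Fixpoint cheb {A : pzRingType} (x : A) (n : nat) : A :=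
  match n with
  | 0 => 1
  | m.+1 => match m with 0 => x | p.+1 => 2 * x * cheb x m - cheb x p end
  end.

Arguments cheb : simpl never.

Lemma chebSS {A : pzRingType} (x : A) n :
  cheb x n.+2 = 2 * x * cheb x n.+1 - cheb x n.
Proof. by []. Qed.

Lemma nat_two_step_ind (P : nat -> Prop) :
  P 0 -> P 1 -> (forall n, P n -> P n.+1 -> P n.+2) -> forall n, P n.
Proof.
move=> P0 P1 PSS n; suff [] : P n /\ P n.+1 by [].
by elim: n => [|n [Pn PSn]]; split => //; apply: PSS.
Qed.

Lemma rmorph_cheb {A B : pzRingType} (f : {rmorphism A -> B}) x n :
  f (cheb x n) = cheb (f x) n.
Proof.
elim/nat_two_step_ind: n => [||n IH0 IH1]; rewrite ?rmorph1 //.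
by rewrite !chebSS rmorphB !rmorphM IH0 IH1 rmorph_nat.
Qed.

Lemma cheb_even_add4 {A : comPzRingType} (x : A) n :
  cheb x n.+4 = (4 * x ^+ 2 - 2) * cheb x n.+2 - cheb x n.
Proof. by rewrite chebSS (chebSS x n.+1) (chebSS x n); ring. Qed.

(** In the recurrence in steps of two, [y ^+ 2 = 1 - x ^+ 2] turns the factor [4 * y ^+ 2 - 2] into
    the opposite of [4 * x ^+ 2 - 2], and the alternating sign absorbs this. *)
Lemma cheb_even_compl {A : comPzRingType} (x y : A) n :
  x ^+ 2 + y ^+ 2 = 1 -> cheb y n.*2 = (-1) ^+ n * cheb x n.*2.
Proof.
move=> xy; elim/nat_two_step_ind: n => [||n IH0 IH1]; first by rewrite mulr1.
  rewrite /cheb /= -!mulrA -!expr2.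
  have -> : y ^+ 2 = 1 - x ^+ 2 by rewrite -xy; ring.
  by rewrite expr1; ring.
rewrite !doubleS !cheb_even_add4 -!doubleS IH0 IH1 !(exprS (-1)).
have -> : y ^+ 2 = 1 - x ^+ 2 by rewrite -xy; ring.
by ring.
Qed.

(** The left side is a quadratic form invariant under the recurrence, so its value at [n = 0]
    persists. *)
Lemma cheb_pell {A : comPzRingType} (x : A) n :
  cheb x n ^+ 2 + cheb x n.+1 ^+ 2 - 2 * x * cheb x n * cheb x n.+1
  = 1 - x ^+ 2.
Proof.
elim: n => [|n IH]; first by rewrite /cheb /=; ring.
by rewrite -IH chebSS; ring.
Qed.

(** Completing the square in [cheb_pell] gives [(1 - x ^+ 2) * cheb x n ^+ 2 <= 1 - x ^+ 2].
    Division fails only for [x ^+ 2 = 1], where the polynomial takes the value [x ^+ n]. *)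
Lemma cheb_le1 {R : realFieldType} (x : R) n :
  `|x| <= 1 -> `|cheb x n| <= 1.
Proof.
rewrite -(@ler_sqr _ `|x|) ?nnegrE // -(@ler_sqr _ `|cheb x n|) ?nnegrE //.
rewrite !real_normK ?num_real // expr1n => x1.
have [x2|x2] := eqVneq (x ^+ 2) 1.
  suff -> : cheb x n = x ^+ n by rewrite -exprM mulnC exprM x2 expr1n.
  elim/nat_two_step_ind: n => [||n IH0 IH1] //; rewrite chebSS IH0 IH1.
  rewrite -[n.+2]addn2 -[n.+1]addn1 !exprD x2 expr1.
  suff -> : 2 * x * (x ^+ n * x) = 2 * x ^+ n * x ^+ 2 by rewrite x2; ring.
  by ring.
have x2_lt1 : 0 < 1 - x ^+ 2 by rewrite subr_gt0 lt_neqAle x2.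
rewrite -(ler_pM2l x2_lt1) mulr1 -subr_ge0 -{1}(cheb_pell x n).
rewrite (_ : _ - _ = (cheb x n.+1 - x * cheb x n) ^+ 2) ?sqr_ge0 //; ring.
Qed.

(** * The Dolph-Chebyshev window *)

Section Weights.
Variables (R : realFieldType) (beta : R).

(* The coefficients, in the basis [cheb _ m], of the product by [2 x] of
   [\sum_m b m * cheb x m]; index 1 is special because [x T_0 = T_1]. *)
Definition cosine_shift (b : nat -> R) (m : nat) : R :=
  match m with
  | 0 => b 1
  | 1 => 2 * b 0 + b 2
  | p.+1 => b p + b m.+1
  end.

Lemma cosine_shiftSS b m : cosine_shift b m.+2 = b m.+1 + b m.+3.
Proof. by []. Qed.

(* The coefficients of [cheb (beta * y) n] in the basis [cheb y m]. *)
Fixpoint dolph (n : nat) : nat -> R :=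
  match n with
  | 0 => fun m => (m == 0)%:R
  | m.+1 => match m with
            | 0 => fun i => (i == 1)%:R * beta
            | p.+1 => fun i => beta * cosine_shift (dolph m) i - dolph p i
            end
  end.

Arguments dolph : simpl never.

Lemma dolphSS n m :
  dolph n.+2 m = beta * cosine_shift (dolph n.+1) m - dolph n m.
Proof. by []. Qed.

Lemma dolph_eq0 n m : (n < m)%N -> dolph n m = 0.
Proof.
elim/nat_two_step_ind: n m => [||n IH0 IH1] m.
- by case: m.
- by case: m => [|[|m]] // _; rewrite /dolph /= mul0r.
case: m => [|[|[|m]]] // nm.
rewrite dolphSS cosine_shiftSS IH0 ?IH1 ?addr0 ?mulr0 ?subr0 //; lia.
Qed.

(** Since [2 y T_m = T_{m+1} + T_{m-1}], truncating the sum leaves two boundary terms; they vanish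
    once [b] is zero beyond [N]. *)
Lemma sum_cosine_shift (b : nat -> R) y N :
  \sum_(m < N.+2) cosine_shift b m * cheb y m =
  2 * y * (\sum_(m < N.+2) b m * cheb y m)
  + b N.+2 * cheb y N.+1 - b N.+1 * cheb y N.+2.
Proof.
elim: N => [|N IH]; first by rewrite !big_ord_recr !big_ord0 /cheb /=; ring.
by rewrite big_ord_recr [in RHS]big_ord_recr /= IH (chebSS y N.+1); ring.
Qed.

(** The length [N] is free, so that the expansions of two consecutive degrees can be added at a
    common length. *)
Lemma cheb_dolph y n N : (n <= N)%N ->
  cheb (beta * y) n = \sum_(m < N.+1) dolph n m * cheb y m.
Proof.
elim/nat_two_step_ind: n N => [||n IH0 IH1] N nN.
- rewrite big_ord_recl /dolph /= big1 ?addr0 ?mulr1 // => i _; by rewrite mul0r.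
- case: N nN => // N _; rewrite !big_ord_recl /dolph /= big1.
    by rewrite /cheb /=; ring.
  by move=> i _; rewrite !mul0r.
case: N nN => // N nN.
rewrite chebSS (IH0 N.+1) ?(IH1 N.+1) 1?ltnW //; last exact: ltnW.
have := sum_cosine_shift (dolph n.+1) y N.
rewrite !dolph_eq0 ?ltnS //; last exact: ltnW.
rewrite !mul0r addr0 subr0 => E.
under [RHS]eq_bigr do rewrite dolphSS mulrBl -mulrA.
by rewrite sumrB -mulr_sumr E; ring.
Qed.

(* Nonnegativity alone is not inductive because of the subtraction in the
   recurrence; the inequality [dolph n m <= dolph n.+1 m.+1] makes it so. *)
Lemma dolph_ge0 n m : 1 <= beta -> 0 <= dolph n m.
Proof.
move=> b1; suff : forall n, [/\ forall m, 0 <= dolph n m,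
    forall m, 0 <= dolph n.+1 m & forall m, dolph n m <= dolph n.+1 m.+1].
  by move=> /(_ n) [].
have mulb (z : R) : 0 <= z -> z <= beta * z.
  by move=> z0; rewrite ler_peMl.
elim=> [|{}n [IH0 IH1 IH]].
  split=> [] [|[|p]]; rewrite /dolph //= ?ler01 ?mul1r ?mul0r //; lra.
(* The subtracted coefficient is, by [IH], at most one term of the shift, which [beta] only
   enlarges; the other term gives the bound. *)
have key p : dolph n.+1 p <= dolph n.+2 p.+1.
  rewrite dolphSS; case: p => [|p] /=.
    have := IH 1; have := mulb _ (IH1 0); have := mulb _ (IH1 2).
    have := IH1 0; have := IH1 2.
    lra.
  have := IH p.+2; have := mulb _ (IH1 p.+1); have := mulb _ (IH1 p.+3).
  lra.
split=> //; case=> [|p]; last exact: le_trans (IH1 _) (key _).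
rewrite dolphSS /=; have := mulb _ (IH1 1); have := IH 0; lra.
Qed.

(** [T_n (beta y)] has the parity of [n] in [y]: the shift flips the parity of the index at each
    degree. *)
Lemma dolph_odd n m :
  odd (n + m) -> dolph n m = 0.
Proof.
elim/nat_two_step_ind: n m => [||n IH0 IH1] m om.
- by case: m om.
- by case: m om => [|[|m]] //= _; rewrite /dolph /= mul0r.
rewrite dolphSS IH0 ?subr0; last by move: om; rewrite !addSn /= negbK.
case: m om => [|[|m]] om /=.
- by rewrite IH1 ?mulr0 //; move: om; rewrite !addSn !addnS /= !negbK.
- by rewrite !IH1 ?mulr0 ?addr0 ?mulr0 //;
    move: om; rewrite !addSn !addnS /= !negbK.
by rewrite !IH1 ?mulr0 ?addr0 ?mulr0 //;
  move: om; rewrite !addSn !addnS /= ?negbK.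
Qed.

End Weights.

Arguments dolph {R}.

Lemma sum_even {V : nmodType} (F : nat -> V) h :
  (forall m, odd m -> F m = 0) ->
  \sum_(m < h.*2.+1) F m = \sum_(j < h.+1) F j.*2.
Proof.
move=> F0; elim: h => [|h IH]; first by rewrite !big_ord1.
by rewrite doubleS 2!big_ord_recr /= IH F0 ?addr0 ?[RHS]big_ord_recr //=
  odd_double.
Qed.

Lemma cheb1 {A : comPzRingType} n : cheb (1 : A) n = 1.
Proof.
elim/nat_two_step_ind: n => [||n IH0 IH1] //.
by rewrite chebSS IH0 IH1 !mulr1 -addrA subrr addr0.
Qed.

(** * Hyperbolic cosine and the choice of [beta] *)

Definition coshR {R : realType} (t : R) : R := (expR t + expR (- t)) / 2.

Lemma cheb_cosh {R : realType} (t : R) n :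
  cheb (coshR t) n = coshR (n%:R * t).
Proof.
elim/nat_two_step_ind: n => [||n IH0 IH1].
- by rewrite /coshR mul0r oppr0 expR0 divff.
- by rewrite mul1r.
rewrite chebSS IH0 IH1 /coshR -!mulrN !expRM_natl expRN !exprS !exprVn.
by field; rewrite expf_neq0 ?expR_eq0.
Qed.

Lemma coshR_ge1 {R : realType} (t : R) : 1 <= coshR t.
Proof.
by rewrite /coshR; have := expR_ge1Dx t; have := expR_ge1Dx (- t); lra.
Qed.

(* i.e. [tanh t <= t] *)
Lemma expR_tanh_le {R : realType} (t : R) : 0 <= t ->
  expR t - expR (- t) <= t * (expR t + expR (- t)).
Proof.
move=> t0.
(* Twice [u cosh u - sinh u]: it vanishes at 0 and its derivative [2 u sinh u] is nonnegative for
   [u >= 0]. *)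
pose g (u : R) := u * (expR u + expR (- u)) - (expR u - expR (- u)).
have dg (u : R) : is_derive u 1 g (u * (expR u - expR (- u))).
  rewrite /g; apply: is_derive_eq.
  rewrite /GRing.scale /=; ring.
have [|c] := @MVT_segment R g _ 0 t t0 (fun u _ => dg u).
  apply: continuous_subspaceT => u.
  by apply: differentiable_continuous; apply/derivable1_diffP.
rewrite in_itv /= => /andP[c0 _].
rewrite /g oppr0 expR0 subrr mul0r !subr0 => E.
rewrite -subr_ge0 E addr0 mulr_ge0 // mulr_ge0 //.
by rewrite subr_ge0 ler_expR; lra.
Qed.

(** As [cosh^2 = 1 + sinh^2], the claim amounts to [sinh t <= |x| cosh t], which follows from
    [tanh t <= t <= |x|]. *)
Lemma coshR_bound {R : realType} (t x : R) :
  0 <= t -> t <= `|x| -> `|x| <= 1 -> coshR t ^+ 2 * (1 - x ^+ 2) <= 1.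
Proof.
move=> t0 tx x1.
have := expR_tanh_le _ t0; rewrite /coshR.
have := expRxMexpNx_1 t.
have := expR_gt0 t; have := expR_gt0 (- t).
have : expR (- t) <= expR t by rewrite ler_expR; lra.
have tx2 : t ^+ 2 <= x ^+ 2.
  by rewrite -[x ^+ 2]real_normK ?num_real // ler_sqr ?nnegrE.
set p := expR t; set q := expR (- t) => qp q0 p0 pq pqt.
have : (p - q) ^+ 2 <= t ^+ 2 * (p + q) ^+ 2.
  have pq0 : 0 <= p - q by rewrite subr_ge0.
  by rewrite -exprMn ler_sqr ?nnegrE // (le_trans pq0).
have : t ^+ 2 * (p + q) ^+ 2 <= x ^+ 2 * (p + q) ^+ 2.
  by rewrite ler_wpM2r ?sqr_ge0.
have -> : (p - q) ^+ 2 = (p + q) ^+ 2 - 4 * (p * q) by ring.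
rewrite pq.
rewrite (_ : ((p + q) / 2) ^+ 2 = (p + q) ^+ 2 / 4); last by field.
move: ((p + q) ^+ 2) => c; lra.
Qed.

(** The witness is arccosh of [z = 1 / eps], that is [ln (z + sqrt (z^2 - 1))]. The root is at most
    [z], which is the origin of the 2 in [ln (2 / eps)]. *)
Lemma exists_coshR {R : realType} (eps : R) : 0 < eps -> eps <= 1 ->
  exists u, [/\ 0 <= u, u <= ln (2 / eps) & coshR u = eps^-1].
Proof.
move=> e0 e1; set z := eps^-1.
have z1 : 1 <= z by rewrite invf_ge1.
have zz : 0 <= z ^+ 2 - 1 by rewrite subr_ge0 exprn_ege1.
set r := Num.sqrt (z ^+ 2 - 1).
have r0 : 0 <= r by rewrite sqrtr_ge0.
have r2 : r ^+ 2 = z ^+ 2 - 1 by rewrite sqr_sqrtr.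
have rz : r <= z by rewrite -ler_sqr ?nnegrE //; lra.
have w0 : 0 < z + r by lra.
exists (ln (z + r)); split.
- by apply: ln_ge0; lra.
- by rewrite ler_ln ?posrE //; lra.
rewrite /coshR expRN lnK ?posrE //.
have -> : (z + r)^-1 = z - r.
  apply: (mulfI (lt0r_neq0 w0)); rewrite divff ?lt0r_neq0 //; nra.
lra.
Qed.

Lemma dolph_chebyshev_window {R : realType} (eps s : R) (h : nat) :
  0 < eps -> eps <= 1 -> (0 < h)%N -> ln (2 / eps) <= h.*2%:R * s ->
  exists w : nat -> R, [/\ forall j, 0 <= w j, \sum_(j < h.+1) w j = 1 &
    forall x, s <= `|x| -> `|x| <= 1 ->
      `|\sum_(j < h.+1) w j * ((-1) ^+ j * cheb x j.*2)| <= eps].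
Proof.
move=> e0 e1 h0 hs; have [u [u0 ul uE]] := exists_coshR _ e0 e1.
have l0 : 0 < h.*2%:R :> R by rewrite ltr0n double_gt0.
(* This choice makes [T_{2h} (beta) = cosh (2h t) = cosh u = 1 / eps]. *)
pose t := u / h.*2%:R; pose beta := coshR t.
have b1 : 1 <= beta by exact: coshR_ge1.
have t0 : 0 <= t by rewrite divr_ge0 // ltW.
have ts : t <= s by rewrite ler_pdivrMr // mulrC (le_trans ul).
have wE y : \sum_(j < h.+1) eps * dolph beta h.*2 j.*2 * cheb y j.*2 =
            eps * cheb (beta * y) h.*2.
  rewrite (cheb_dolph _ _ _ _ _ (leqnn _)).
  rewrite (sum_even (fun m => dolph beta h.*2 m * cheb y m)).
    by rewrite mulr_sumr; apply: eq_bigr => j _; rewrite mulrA.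
  by move=> m om; rewrite dolph_odd ?mul0r // oddD odd_double.
exists (fun j => eps * dolph beta h.*2 j.*2); split.
- by move=> j; rewrite mulr_ge0 ?dolph_ge0 // ltW.
(* As every [T_m (1)] is 1, the sum of the weights is the window at [y = 1], namely
   [eps * cosh u = 1]. *)
- have := wE 1; under eq_bigr do rewrite cheb1 mulr1.
  move=> ->; rewrite mulr1 cheb_cosh /t mulrC (mulrC _ (u / _)).
  rewrite divfK ?gt_eqF // uE.
  by rewrite mulVf ?gt_eqF.
move=> x sx x1; pose y := Num.sqrt (1 - x ^+ 2).
have x2 : x ^+ 2 <= 1 by rewrite -real_normK ?num_real // expr_le1.
have y2 : y ^+ 2 = 1 - x ^+ 2 by rewrite sqr_sqrtr ?subr_ge0.
have xy : x ^+ 2 + y ^+ 2 = 1 by rewrite y2 subrKC.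
under eq_bigr do rewrite -(cheb_even_compl x y _ xy).
rewrite wE normrM gtr0_norm // ger_pMr //; apply: cheb_le1.
rewrite -(@ler_sqr _ `|_|) ?nnegrE // real_normK ?num_real // expr1n exprMn y2.
by apply: coshR_bound => //; apply: le_trans ts sx.
Qed.

(** * The walk on an eigenvector *)

Section Qubitization.
Variables (C : numClosedFieldType) (N : nat).
Implicit Types (P V : 'M[C]_N) (phi v : 'cV[C]_N).

Definition mxrefl P : 'M[C]_N := 2 *: P - 1%:M.

Definition walk2 P V : 'M[C]_N :=
  mxrefl P *m (V^t* *m (mxrefl P *m V)).

Lemma mxreflE P m (v : 'M[C]_(N, m)) : mxrefl P *m v = 2 *: (P *m v) - v.
Proof. by rewrite mulmxBl mul1mx scalemxAl. Qed.

Lemma mxreflK P : P *m P = P -> mxrefl P *m mxrefl P = 1%:M.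
Proof.
move=> PP; rewrite mxreflE mulmxBr mulmx1 -scalemxAr PP /mxrefl.
by rewrite !scaler_nat !mulr2n addrK subKr.
Qed.

(** Up to phases, the left side is the gate sequence walk, reflection, inverse walk, reflection; two
    of the three adjacent reflections in the middle cancel. *)
Lemma walk2_alt P V m (U : 'M[C]_(N, m)) : P *m P = P ->
  mxrefl P *m (V^t* *m mxrefl P *m (mxrefl P *m (mxrefl P *m V *m U))) =
  walk2 P V *m U.
Proof.
move=> PP; rewrite /walk2 -!mulmxA (mulmxA (mxrefl P) (mxrefl P)).
by rewrite mxreflK // mul1mx.
Qed.

Lemma iter_mulmx_comb (G : 'M[C]_N) j (a : C) (u v : 'cV[C]_N) :
  iter j (mulmx G) (a *: u - v) =
  a *: iter j (mulmx G) u - iter j (mulmx G) v.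
Proof. by elim: j => //= j ->; rewrite mulmxBr scalemxAr. Qed.

Lemma unitarymx_trC_mul V : V \is unitarymx -> V^t* *m V = 1%:M.
Proof. by move=> /mulmxKtV VV; rewrite -[LHS]mul1mx mulmxA VV. Qed.

Lemma iter_walk2 P V phi x j :
  P *m P = P -> V \is unitarymx -> P *m phi = phi ->
  P *m (V *m phi) = x *: phi -> P *m (V^t* *m phi) = x *: phi ->
  P *m iter j (mulmx (walk2 P V)) phi = cheb x j.*2 *: phi.
Proof.
move=> PP /[dup] /unitarymxP VV' /unitarymx_trC_mul VV PE VE VtE.
pose s := mxrefl P *m (V^t* *m phi).
have Rphi : mxrefl P *m phi = phi by rewrite mxreflE PE scaler_nat mulr2n addrK.
have PR (v : 'cV[C]_N) : P *m (mxrefl P *m v) = P *m v.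
  by rewrite mxreflE mulmxBr -scalemxAr mulmxA PP scaler_nat mulr2n addrK.
have Ps : P *m s = x *: phi by rewrite PR.
have Gphi : walk2 P V *m phi = (2 * x) *: s - phi.
  rewrite -!mulmxA [mxrefl P *m (V *m phi)]mxreflE VE !mulmxBr scalerA.
  by rewrite -!scalemxAr (mulmxA _ V) VV mul1mx Rphi.
have Vs : V *m s = (2 * x) *: (V *m phi) - phi.
  by rewrite /s mxreflE VtE mulmxBr scalerA -scalemxAr mulmxA VV' mul1mx.
have Gs : walk2 P V *m s = (2 * x) *: (walk2 P V *m phi) - s.
  by rewrite -!mulmxA Vs !mulmxBr -!scalemxAr Rphi.
(* The induction is simultaneous: the orbit of [phi] carries the even indices and that of [s] the
   odd ones. *)
suff [] : P *m iter j (mulmx (walk2 P V)) phi = cheb x j.*2 *: phi /\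
  P *m iter j (mulmx (walk2 P V)) s = cheb x j.*2.+1 *: phi by [].
elim: j => [|j [IH0 IH1]]; first by rewrite /= PE Ps scale1r.
have E : P *m iter j.+1 (mulmx (walk2 P V)) phi = cheb x j.*2.+2 *: phi.
  rewrite iterSr Gphi iter_mulmx_comb mulmxBr -scalemxAr IH0 IH1 scalerA.
  by rewrite -scalerBl.
split=> //; rewrite iterSr Gs iter_mulmx_comb mulmxBr -scalemxAr -iterSr E IH1.
by rewrite scalerA -scalerBl doubleS -chebSS.
Qed.

(** * Norms, projections and Hermitian eigenvectors *)

Definition sqnorm (v : 'cV[C]_N) : C := (v^t* *m v) 0 0.

Lemma sqnormE v : sqnorm v = \sum_i `|v i 0| ^+ 2.
Proof.
rewrite /sqnorm mxE; apply: eq_bigr => i _.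
by rewrite !mxE normCK mulrC.
Qed.

Lemma sqnorm_gt0 v : v != 0 -> 0 < sqnorm v.
Proof.
move=> v0; rewrite sqnormE lt0r sumr_ge0 => [|i _]; last by rewrite exprn_ge0.
rewrite andbT psumr_neq0 => [|i _]; last by rewrite exprn_ge0.
apply: contraNT v0 => /hasPn v0; apply/eqP/matrixP => i j.
rewrite ord1 mxE; apply/eqP; have := v0 i (mem_index_enum _).
by rewrite lt0r exprn_ge0 // andbT negbK expf_eq0 /= normr_eq0.
Qed.

Lemma sqnorm_ge0 v : 0 <= sqnorm v.
Proof. by rewrite sqnormE sumr_ge0 // => i _; rewrite exprn_ge0. Qed.

Lemma trCmxM m n p (A : 'M[C]_(m, n)) (B : 'M[C]_(n, p)) :
  (A *m B)^t* = B^t* *m A^t*.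
Proof. by rewrite trmx_mul map_mxM. Qed.

Lemma trCmxB m n (A B : 'M[C]_(m, n)) : (A - B)^t* = A^t* - B^t*.
Proof. by apply/matrixP => i j; rewrite !mxE rmorphB. Qed.

Lemma sqnorm_unitary V v : V \is unitarymx -> sqnorm (V *m v) = sqnorm v.
Proof.
move=> VU; rewrite /sqnorm trCmxM mulmxA -(mulmxA (v^t*)).
by rewrite unitarymx_trC_mul // mulmx1.
Qed.

(** Pythagoras: the difference of the two sides is [sqnorm (v - P *m v)]. *)
Lemma sqnorm_proj P v : P *m P = P -> P^t* = P ->
  sqnorm (P *m v) <= sqnorm v.
Proof.
move=> PP PT; rewrite -subr_ge0.
suff <- : sqnorm (v - P *m v) = sqnorm v - sqnorm (P *m v) by exact: sqnorm_ge0.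
rewrite /sqnorm !trCmxM PT.
rewrite trCmxB trCmxM PT.
rewrite mulmxBl !mulmxBr !mulmxA -(mulmxA _ P P) PP subrr subr0.
by rewrite !mxE.
Qed.

(** A compression of a unitary is a contraction. This yields [|mu / n| <= 1] from the block encoding
    alone, without estimating the norm of [BG]. *)
Lemma block_eigen_le1 P V phi x :
  P *m P = P -> P^t* = P -> V \is unitarymx -> phi != 0 ->
  P *m (V *m phi) = x *: phi -> `|x| <= 1.
Proof.
move=> PP PT VU phi0 VE.
have := sqnorm_proj P (V *m phi) PP PT; rewrite VE sqnorm_unitary //.
rewrite !sqnormE; under eq_bigr do rewrite mxE normrM exprMn.
rewrite -mulr_sumr -sqnormE -[leRHS]mul1r ler_pM2r ?sqnorm_gt0 //.
by rewrite expr_le1.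
Qed.

(** Bracketing [phi^t* *m B *m phi] in two ways shows that [mu] is its own conjugate. As
    [eigenvalue] concerns row vectors, its witness is the adjoint of [phi]. *)
Lemma hermitian_eigen_real (B : 'M[C]_N) phi mu :
  B^t* = B -> phi != 0 -> B *m phi = mu *: phi ->
  mu \is Num.real /\ eigenvalue B mu.
Proof.
move=> BT phi0 BE.
have BtE : phi^t* *m B = mu^* *: phi^t*.
  rewrite -[in LHS]BT -trCmxM BE.
  by apply/matrixP => i j; rewrite !mxE rmorphM.
have muR : mu^* = mu.
  have ZE (a : C) (M : 'M[C]_1) : (a *: M) 0 0 = a * M 0 0 by rewrite mxE.
  have := congr1 (fun M : 'M[C]_1 => M 0 0) (mulmxA (phi^t*) B phi).
  rewrite /= BE BtE -scalemxAr -scalemxAl !ZE => /esym.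
  by apply: mulIf; rewrite gt_eqF // sqnorm_gt0.
split; first by apply/CrealP.
apply/eigenvalueP; exists (phi^t*); first by rewrite BtE muR.
apply: contraNneq phi0 => /(congr1 (fun M => M^t*)); rewrite trmxCK => ->.
by rewrite trmx0 map_mx0.
Qed.

End Qubitization.

Arguments mxrefl {C N}.
Arguments walk2 {C N}.
Arguments sqnorm {C N}.

(** * Block encodings *)

Section BlockEncoding.
Variables (R : realType) (n : nat) (e : rel 'I_n).
Local Notation C := R[i].

Lemma ketbraE (x y : bits n) :
  ketbra R x y = delta_mx (enum_rank x) (enum_rank y).
Proof.
by rewrite /ketbra /ket trmx_delta map_delta_mx mul_delta_mx.
Qed.

Lemma trC_ketbra (x y : bits n) : (ketbra R x y)^t* = ketbra R y x.
Proof. by rewrite !ketbraE trmx_delta map_delta_mx. Qed.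

Lemma trC_clique_proj j : (clique_proj R e j)^t* = clique_proj R e j.
Proof.
rewrite /clique_proj !raddf_sum /=.
by apply: eq_bigr => x _; rewrite trC_ketbra.
Qed.

Lemma mul_clique_proj i j :
  clique_proj R e i *m clique_proj R e j =
  if i == j then clique_proj R e i else 0.
Proof.
rewrite /clique_proj mulmx_suml.
have E x : is_clique e i x ->
    ketbra R x x *m (\sum_(y | is_clique e j y) ketbra R y y) =
    if i == j then ketbra R x x else 0.
  move=> xi; rewrite mulmx_sumr; case: eqP => [<-|ij].
    rewrite (bigD1 x) //= big1 => [|y /andP[_ yx]].
      by rewrite addr0 ketbraE mul_delta_mx.
    by rewrite !ketbraE mul_delta_mx_0 // (inj_eq enum_rank_inj) eq_sym.
  apply: big1 => y /andP[/eqP yj _]; rewrite !ketbraE mul_delta_mx_0 //.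
  rewrite (inj_eq enum_rank_inj); apply: contra_not_neq ij => xy.
  by case/andP: xi => /eqP <- _; rewrite xy.
by rewrite (eq_bigr _ E); case: eqP => // _; rewrite big1.
Qed.

Lemma trC_PG k : (PG R e k)^t* = PG R e k.
Proof. by rewrite /PG !linearD /= !map_mxD !trC_clique_proj. Qed.

(** Positivity keeps the sizes [k.-1], [k], [k.+1] distinct; at [k = 0] the first two coincide and a
    projector is counted twice. *)
Lemma mul_PG k : (0 < k)%N -> PG R e k *m PG R e k = PG R e k.
Proof.
case: k => // k _; rewrite /PG /= !mulmxDl !mulmxDr !mul_clique_proj.
rewrite !eqxx; have -> : (k == k.+1) = false by lia.
have -> : (k == k.+2) = false by lia.
have -> : (k.+1 == k) = false by lia.
have -> : (k.+1 == k.+2) = false by lia.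
have -> : (k.+2 == k) = false by lia.
have -> : (k.+2 == k.+1) = false by lia.
by rewrite !addr0 !add0r.
Qed.

Lemma trC_BG k : (BG R e k)^t* = BG R e k.
Proof.
rewrite /BG !linearD /= !map_mxD !trmxCK.
rewrite [boundary _ _ _ + _]addrC -!addrA; congr (_ + (_ + _)).
by rewrite addrC.
Qed.

Variable a : nat.

Lemma trC_tens m p q r (A : 'M[C]_(m, p)) (B : 'M[C]_(q, r)) :
  (A *t B)^t* = A^t* *t B^t*.
Proof. by rewrite trmx_tens map_mxT. Qed.

Lemma trC_anc0 k : (anc0 R e a k)^t* = anc0 R e a k.
Proof. by rewrite trC_tens trC_PG trmx_delta map_delta_mx. Qed.

Lemma mul_anc0 k : (0 < k)%N -> anc0 R e a k *m anc0 R e a k = anc0 R e a k.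
Proof. by move=> k0; rewrite tensmx_mul mul_delta_mx mul_PG. Qed.

End BlockEncoding.

(** * The linear combination of unitaries *)

Section Filter.
Variables (R : realType) (h : nat).
Local Notation C := R[i].

(* Each power of the walk occurs twice, without and with a final reflection,
   since [P] is the mean of the identity and [2 P - 1]. *)
Local Notation term := 'I_(h.+1 + h.+1).

Definition term_power (j : term) : nat :=
  match fintype.split j with inl i => i | inr i => i end.

(** Block [s] acts only in the branches whose power exceeds [s]. All branches thus share the same
    [h] blocks, of two calls each. *)
Definition power_block (s : nat) : seq (gate (h.+1 + h.+1)) :=
  let D := [set j | (s < term_power j)%N] in
  [:: Walk D; Refl D; WalkInv D; Refl D].

Definition filter_gates : seq (gate (h.+1 + h.+1)) :=
  rcons (flatten [seq power_block s | s <- iota 0 h])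
        (Refl [set j : term | (h < j)%N]).

Lemma filter_gates_calls : (\sum_(g <- filter_gates) gate_calls g = h.*2)%N.
Proof.
rewrite big_rcons_op /= addn0 big_flatten /= big_map.
rewrite (eq_bigr (fun=> 2)) => [|s _]; last by rewrite !big_cons big_nil.
rewrite big_const_seq count_predT size_iota iter_addn_0; lia.
Qed.

(** The sign comes from [cheb_even_compl], and the half from writing [P] as the mean of the identity
    and its reflection. *)
Definition filter_weight (w : nat -> R) (j : term) : C :=
  (w (term_power j) * (-1) ^+ term_power j / 2)%:C.

Lemma norm_real_complex (x : R) : `|x%:C| = `|x|%:C.
Proof. by rewrite normc_def /= expr0n addr0 sqrtr_sqr. Qed.

Lemma term_powerl i : term_power (lshift h.+1 i) = i.
Proof.
rewrite /term_power; case: split_ordP => k /eqP;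
  by rewrite (eq_lshift, eq_lrshift) // => /eqP ->.
Qed.

Lemma term_powerr i : term_power (rshift h.+1 i) = i.
Proof.
rewrite /term_power; case: split_ordP => k /eqP;
  by rewrite (eq_rshift, eq_rlshift) // => /eqP ->.
Qed.

Lemma filter_weight_sum (w : nat -> R) : (forall j, 0 <= w j) ->
  \sum_(j < h.+1) w j = 1 -> \sum_j `|filter_weight w j| = 1.
Proof.
move=> w0 w1; rewrite big_split_ord /= -big_split /=.
transitivity ((\sum_(j < h.+1) w j)%:C); last by rewrite w1.
rewrite raddf_sum; apply: eq_bigr => j _.
rewrite /filter_weight term_powerl term_powerr norm_real_complex.
rewrite !normrM normrX normrN1 expr1n mulr1 ger0_norm // gtr0_norm ?invr_gt0 //.
by rewrite -raddfD /= -splitr.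
Qed.

Section Action.
Variables (n : nat) (e : rel 'I_n) (k a : nat).
Variable V : 'M[C]_(a.+1 * qdim n).
Hypotheses (k0 : (0 < k)%N) (VU : V \is unitarymx).
Let P := anc0 R e a k.
Let PP : P *m P = P := mul_anc0 _ _ _ _ _ k0.

Lemma invmx_walk : invmx (walk e k V) = - 'i%C *: (V^t* *m mxrefl P).
Proof.
have E : walk e k V *m (- 'i%C *: (V^t* *m mxrefl P)) = 1%:M.
  rewrite /walk -scalemxAl -scalemxAr scalerA mulmxA -(mulmxA _ V).
  rewrite (unitarymxP VU) mulmx1 mxreflK // mulrN -expr2 sqr_i opprK.
  by rewrite scale1r.
have [U _] := mulmx1_unit E.
by rewrite -[RHS]mul1mx -(mulVmx U) -mulmxA E mulmx1.
Qed.

(** The phases [i] of the walk and [-i] of its inverse cancel, leaving exactly [walk2]. *)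
Lemma power_block_action s j (U : 'M[C]_(a.+1 * qdim n)) :
  foldl (fun U g => gate_on e k V j g *m U) U (power_block s) =
  if (s < term_power j)%N then walk2 P V *m U else U.
Proof.
rewrite /= !finset.in_set; case: ifP => _; last by rewrite !mul1mx.
have -> : refl R e a k = mxrefl P by [].
rewrite invmx_walk /walk -!(scalemxAl, scalemxAr) scalerA mulNr -expr2.
by rewrite sqr_i opprK scale1r (walk2_alt _ _ _ _ _ _ PP).
Qed.

Lemma filter_gates_action j (v : 'cV[C]_(a.+1 * qdim n)) :
  foldl (fun U g => gate_on e k V j g *m U) 1%:M filter_gates *m v =
  (if (h < j)%N then mxrefl P else 1%:M) *m
  iter (term_power j) (mulmx (walk2 P V)) v.
Proof.
rewrite foldl_rcons /= finset.in_set.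
set U := foldl _ _ _; rewrite -mulmxA; congr (_ *m _).
(* After [t] blocks, branch [j] has applied [walk2] until reaching its own power, whence the
   minimum. *)
suff UE t : foldl (fun U g => gate_on e k V j g *m U) 1%:M
    (flatten [seq power_block s | s <- iota 0 t]) *m v =
    iter (minn t (term_power j)) (mulmx (walk2 P V)) v.
  rewrite UE; congr (iter _ _ _); apply/minn_idPr.
  by rewrite /term_power; case: fintype.split => i; rewrite -ltnS.
elim: t => [|t IH]; first by rewrite min0n mul1mx.
rewrite -[t.+1]addn1 iotaD map_cat flatten_cat foldl_cat.
have -> : flatten [seq power_block s | s <- iota (0 + t) 1] = power_block t.
  by [].
rewrite power_block_action addn1.
case: ltnP => tj; last by rewrite IH !(minn_idPr _) // leqW.
by rewrite -mulmxA IH !(minn_idPl _) // ltnW.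
Qed.

End Action.
End Filter.

Lemma tensmxZr (C : comPzRingType) m p q r (A : 'M[C]_(m, p)) (c : C)
    (B : 'M[C]_(q, r)) : A *t (c *: B) = c *: (A *t B).
Proof. by apply/matrixP => i j; rewrite !mxE mulrCA. Qed.

Lemma tens_delta_eq0 (C : comPzRingType) m q (B : 'cV[C]_q) :
  (delta_mx 0 0 : 'cV[C]_m.+1) *t B = 0 -> B = 0.
Proof.
move=> E; apply/matrixP => i j; rewrite ord1.
have := tensmxE (delta_mx 0 0 : 'cV[C]_m.+1) B 0 i 0 0.
by rewrite E !mxE !eqxx mul1r.
Qed.

Lemma tens_delta_mulmx (C : comPzRingType) m q (A : 'M[C]_q) (B : 'cV[C]_q) :
  ((delta_mx 0 0 : 'M[C]_m.+1) *t A) *m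
    ((delta_mx 0 0 : 'cV[C]_m.+1) *t B : 'cV[C]_(m.+1 * q)) =
  (delta_mx 0 0 : 'cV[C]_m.+1) *t (A *m B).
Proof.
rewrite -[in RHS](mul_delta_mx (0 : 'I_m.+1) 0 0).
exact: (tensmx_mul _ _ (delta_mx 0 0 : 'cV[C]_m.+1) B).
Qed.

(** * The filter on an eigenvector of [BG] *)

Section Encoding.
Variables (R : realType) (n : nat) (e : rel 'I_n) (k a : nat).
Local Notation C := R[i].
Variable V : 'M[C]_(a.+1 * qdim n).
Hypotheses (k0 : (0 < k)%N) (VB : block_encoding e k V).
Variables (psi : 'cV[C]_(qdim n)) (mu : C).
Hypotheses (Ppsi : PG R e k *m psi = psi) (Bpsi : BG R e k *m psi = mu *: psi).
Let phi : 'cV[C]_(a.+1 * qdim n) := (delta_mx 0 0 : 'cV[C]_a.+1) *t psi.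
Let P := anc0 R e a k.

Lemma anc0_eigenvector : P *m phi = phi.
Proof. by rewrite /P /anc0 /phi tens_delta_mulmx Ppsi. Qed.

Lemma block_encoding_eigenvector : P *m (V *m phi) = (n%:R^-1 * mu) *: phi.
Proof.
rewrite -{1}anc0_eigenvector !mulmxA VB.2 tens_delta_mulmx.
by rewrite -scalemxAl Bpsi scalerA tensmxZr.
Qed.

(** [anc0] and [BG] are Hermitian and [n] is real, so the adjoint of [V] encodes the same block. *)
Lemma block_encoding_adj_eigenvector :
  P *m (V^t* *m phi) = (n%:R^-1 * mu) *: phi.
Proof.
have E : P *m V^t* *m P = (delta_mx 0 0 : 'M[C]_a.+1) *t (n%:R^-1 *: BG R e k).
  rewrite -[P](trC_anc0 R n e a k) -trCmxM -trCmxM mulmxA VB.2.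
  rewrite trC_tens trmx_delta map_delta_mx; congr (_ *t _).
  apply/matrixP => i j; rewrite -[in RHS](trC_BG R n e k) !mxE rmorphM.
  by rewrite fmorphV rmorph_nat.
rewrite -{1}anc0_eigenvector !mulmxA E tens_delta_mulmx.
by rewrite -scalemxAl Bpsi scalerA tensmxZr.
Qed.

Lemma block_encoding_eigenvalue : (0 < n)%N -> psi != 0 ->
  exists m : R, [/\ mu = m%:C, eigenvalue (BG R e k) mu & `|m / n%:R| <= 1].
Proof.
move=> n0 psi0.
have [/complex_realP[m mE] ev] :=
  hermitian_eigen_real _ _ _ _ _ (trC_BG R n e k) psi0 Bpsi.
exists m; split=> //.
have phi0 : phi != 0 by apply: contraNneq psi0 => /tens_delta_eq0 ->.
have := block_eigen_le1 _ _ _ _ _ _ (mul_anc0 R n e a k k0)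
  (trC_anc0 R n e a k) VB.1 phi0 block_encoding_eigenvector.
rewrite mE (_ : n%:R^-1 * m%:C = (m / n%:R)%:C).
  by rewrite norm_real_complex (lecR _ 1).
by rewrite rmorphM fmorphV rmorph_nat mulrC.
Qed.

Lemma filter_action h (w : nat -> R) (x : R) pf :
  (n%:R^-1 * mu) = x%:C ->
  lcu_op e k V (@Lcu R _ (filter_weight R h w) (filter_gates h) pf) *m phi =
  (\sum_(j < h.+1) w j * ((-1) ^+ j * cheb x j.*2))%:C *: phi.
Proof.
move=> mux; rewrite /lcu_op /= mulmx_suml.
under [LHS]eq_bigr => j _.
  rewrite -scalemxAl (filter_gates_action R h n e k a V k0 VB.1).
  over.
(* The two terms of power [j] have equal weight and add up to [v + (2 P v - v) = 2 P v], which
   cancels the half. *)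
rewrite big_split_ord /= -big_split /= raddf_sum /= scaler_suml.
apply: eq_bigr => j _.
rewrite /filter_weight term_powerl term_powerr -scalerDr /=.
rewrite ltnNge leq_ord /= ltnS leq_addr mul1mx mxreflE.
rewrite (iter_walk2 _ _ _ _ _ (n%:R^-1 * mu)) ?mul_anc0 ?VB.1 ?anc0_eigenvector
  ?block_encoding_eigenvector ?block_encoding_adj_eigenvector //.
rewrite addrC subrK mux -rmorph_cheb !scalerA.
rewrite -(rmorph_nat (real_complex R)) -!rmorphM /=.
by congr ((_)%:C *: _); field.
Qed.

End Encoding.

Lemma BG_no_qubit (R : realType) (e : rel 'I_0) k : BG R e k = 0.
Proof.
suff B0 j : boundary R e j = 0 by rewrite /BG !B0 trmx0 map_mx0 !addr0.
rewrite /boundary big1 // => x /andP[/eqP + _].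
by have := max_card (mem (ones x)); rewrite card_ord leqn0 => /eqP ->.
Qed.

Theorem lemma6 (R : realType) (n : nat) (lmin eps : R)
    (lmin_gt0 : 0 < lmin) (eps_gt0 : 0 < eps) (eps_le1 : eps <= 1) :
  exists c : lcu R,
    (* n / lmin * ln (2 / eps), rounded up to an even integer *)
    (lcu_calls c)%:Z = 2 * Num.ceil (n%:R / lmin * ln (2 / eps) / 2) /\
    forall (e : rel 'I_n) (k : nat),
      symmetric e -> irreflexive e -> (0 < k)%N ->
      gap_at_least e k lmin ->
      forall (a : nat) (V : 'M[R[i]]_(a.+1 * qdim n)),
        block_encoding e k V -> filters e k V eps c.
Proof.
(* Without qubits no call is allowed and [mu / n] is meaningless, but [BG] is 0 and the identity is
   a filter. *)
have [n0|n_gt0] := posnP n.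
  subst n.
  have one_sum : \sum_(j < 1) `|(1 : R[i])| = 1 by rewrite big_ord1 normr1.
  exists (@Lcu R 1 (fun=> 1) [::] one_sum); split.
    by rewrite /lcu_calls big_nil !mul0r ceil0 mulr0.
  move=> e k _ _ _ _ a V _ psi mu psi0 _; rewrite BG_no_qubit mul0mx => mupsi.
  split=> [_|mu0]; first by rewrite /lcu_op big_ord1 scale1r mul1mx.
  by move/esym/eqP: mupsi; rewrite scaler_eq0 (negbTE mu0) (negbTE psi0).
(* [N] is half the target count: each of the [h = ceil N] blocks costs two calls. It is positive
   because [eps <= 1 < 2], so [h] is not 0. *)
set N := n%:R / lmin * ln (2 / eps) / 2.
have nR : 0 < n%:R :> R by rewrite ltr0n.
have ln2 : 0 < ln (2 / eps).
  by rewrite ln_gt0 // ltr_pdivlMr // mul1r (le_lt_trans eps_le1) // ltr1n.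
have N0 : 0 < N by rewrite !mulr_gt0 ?invr_gt0.
have [h hE] : exists h : nat, Num.ceil N = h%:Z.
  by exists `|Num.ceil N|%N; rewrite gez0_abs // ltW // ceil_gt0.
have h0 : (0 < h)%N by rewrite -ltz_nat -hE ceil_gt0.
have hN : N <= h%:R by have := ceil_ge N; rewrite hE.
have bound : ln (2 / eps) <= h.*2%:R * (lmin / n%:R).
  rewrite (_ : ln (2 / eps) = N * 2 * (lmin / n%:R)).
    apply: ler_wpM2r; first by rewrite divr_ge0 // ltW.
    by rewrite -muln2 natrM ler_pM2r.
  by rewrite /N; field; rewrite !gt_eqF.
have [w [w0 w1 wx]] := dolph_chebyshev_window _ _ _ eps_gt0 eps_le1 h0 bound.
exists (@Lcu R _ _ (filter_gates h) (filter_weight_sum R h w w0 w1)); split.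
  by rewrite /lcu_calls filter_gates_calls hE -muln2 mulnC PoszM.
move=> e k _ _ k0 gap a V VB psi mu psi0 Ppsi Bpsi phi.
have [m [mE ev m1]] :=
  block_encoding_eigenvalue R n e k a V k0 VB psi mu Ppsi Bpsi n_gt0 psi0.
have xE : n%:R^-1 * mu = (m / n%:R)%:C.
  by rewrite mE rmorphM fmorphV rmorph_nat mulrC.
rewrite (filter_action _ _ _ _ _ _ k0 VB psi mu Ppsi Bpsi _ _ _ _ xE).
split=> [mu0|mu0].
  have m0 : m = 0 by move: mE; rewrite mu0 => -[].
  rewrite m0 mul0r (_ : \sum_(j < _) _ = 1) ?scale1r // -[RHS]w1.
  apply: eq_bigr => j _.
  (* [T_{2j} (0) = (-1)^j] cancels the sign, so the kernel amplitude is the sum of the weights,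
     exactly 1. *)
  by rewrite -(cheb_even_compl 0 1) ?cheb1 ?mulr1 // expr0n expr1n add0r.
exists (\sum_(j < h.+1) w j * ((-1) ^+ j * cheb (m / n%:R) j.*2))%:C => //.
rewrite norm_real_complex lecR; apply: wx => //.
rewrite normrM normfV (gtr0_norm nR) ler_pM2r ?invr_gt0 //.
by have := gap _ ev mu0; rewrite mE norm_real_complex lecR.
Qed.
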